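(* Let $A\in\mathbb R^{n\times n}$, let $F\in\mathbb R^{n\times n}$ be symmetric positive definite with Cholesky factorization $F=LL^\top$, and let $Q\in\mathbb R^{n\times n}$ be symmetric positive definite. Assume $\mathcal W(L^{-1}AL)\subset\mathbb C^-$, and let $\widetilde X_0\in\mathbb R^{n\times n}$ be symmetric and positive semidefinite such that $\widetilde A_{cl,0}=A-F\widetilde X_0$ is stable. Consider the sequence $\{\widetilde X_k\}_{k\ge0}$ generated from $\widetilde X_0$ by the inexact Newton–Kleinman iteration with line search and without truncation described in the context, and assume that in each outer iteration $k$ the number $\overline{it}_k$ of GMRES iterations satisfies $$\overline{it}_k\ \ge\ -\,2\log\left((1+\sqrt2)\,\frac{\kappa(F)\,\|\widetilde X_kF\widetilde X_k+Q\|_F}{\lambda_{\min}(Q)}\right)\Bigg/\log\left(1-\frac{\lambda_{\min}^2\big((\widetilde{\mathcal L}_k+\widetilde{\mathcal L}_k^\top)/2\big)}{\lambda_{\max}(\widetilde{\mathcal L}_k\widetilde{\mathcal L}_k^\top)}\right),$$ where $$\widetilde{\mathcal L}_k:=(L\otimes L^\top)\,\widetilde{\mathcal A}_k\,(L^{-1}\otimes L^{-\top})=I\otimes L^\top\widetilde A_{cl,k}^\top L^{-\top}+L\widetilde A_{cl,k}L^{-1}\otimes I .$$ If there exists $\bar\lambda>0$ such that the step lengths satisfy $\lambda_k\ge\bar\lambda$ for all $k$, then $\|\mathcal R(\widetilde X_k)\|_F\to0$ and $\widetilde X_k\to X^*$, where $X^*>0$ is the unique stabilizing solution of $A^\top 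X+XA-XFX+Q=0$.
   Context: $\mathbb C^-=\{z\in\mathbb C:\Re(z)<0\}$; $\mathcal W(M)=\{x^HMx:\ x\in\mathbb C^n,\ \|x\|_2=1\}$ is the numerical range; $\kappa(F)$ is the 2-norm condition number; $\lambda_{\min},\lambda_{\max}$ are the minimum and maximum eigenvalues of a symmetric matrix; $\|\cdot\|_F$ is the Frobenius norm; $\otimes$ is the Kronecker product. A matrix is called stable if its eigenvalues have non positive real parts. $\mathcal R(X):=A^\top X+XA-XFX+Q$. The stabilizing solution of $\mathcal R(X)=0$ is its unique real symmetric positive semidefinite solution $X$; it has the property that $A-FX$ is stable. $X^*>0$ means that $X^*$ is positive definite. Inexact Newton–Kleinman iteration with line search and without truncation: given $\widetilde X_k$, let $\widetilde A_{cl,k}:=A-F\widetilde X_k$ and $$\widetilde{\mathcal A}_k:=I\otimes\widetilde A_{cl,k}^\top+\widetilde A_{cl,k}\otimes I\in\mathbb R^{n^2\times n^2}.$$ The linear system $\widetilde{\mathcal A}_kx=-\mathrm{vec}(\widetilde X_kF\widetilde X_k+Q)$ is the vectorized form used for the Lyapunov equation $\widetilde A_{cl,k}^\top X+X\widetilde A_{cl,k}=-\widetilde X_kF\widetilde X_k-Q$. Run $\overline{it}_k$ iterations of GMRES with zero initial guess on this linear system, and let $\widehat X_{k+1}$ be the $n\times n$ matrix obtained by reshaping the resulting approximate solution. Then set $$\widetilde X_{k+1}=(1-\lambda_k)\widetilde X_k+\lambda_k\widehat X_{k+1},$$ where the step length $\lambda_k\in(0,1)$ is selected by line search so that $$\|\mathcal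 R((1-\lambda_k)\widetilde X_k+\lambda_k\widehat X_{k+1})\|_2\le(1-\lambda_k\alpha)\,\|\mathcal R(\widetilde X_k)\|_2$$ for a certain $\alpha>0$. The iteration is considered without stopping criterion, so that it generates an infinite sequence.
   Formalization: The Kronecker matrices are corrected to the true Lyapunov matrix I⊗A_cl^T + A_cl^T⊗I and its scaled form (that of L^{-1}A_cl L), and λ_min² is taken of −(L_k+L_k^T)/2, i.e. the eigenvalue of smallest modulus; with the printed λ_min the claim is false. *)

(* Defs.v *)
From mathcomp Require Import all_boot all_order all_algebra.
From mathcomp Require Import complex mxtens.
From mathcomp Require Import all_classical all_reals all_analysis.

Set Implicit Arguments.
Unset Strict Implicit.
Unset Printing Implicit Defensive.

Import Order.TTheory GRing.Theory Num.Theory.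
Import numFieldNormedType.Exports.

Local Open Scope classical_set_scope.
Local Open Scope complex_scope.
Local Open Scope ring_scope.

Section MatrixNotions.
Variable R : realType.

Definition sym_pos_def n (M : 'M[R]_n) :=
  M^T = M /\ forall x : 'cV[R]_n, x != 0 -> 0 < (x^T *m M *m x) 0 0.

Definition sym_pos_semidef n (M : 'M[R]_n) :=
  M^T = M /\ forall x : 'cV[R]_n, 0 <= (x^T *m M *m x) 0 0.

(* [is_trig_mx] means lower triangular. *)
Definition cholesky_factor n (F L : 'M[R]_n) :=
  [/\ is_trig_mx L, forall i, 0 < L i i & F = L *m L^T].

(* "Stable" allows eigenvalues on the imaginary axis. *)
Definition stable n (M : 'M[R]_n) :=
  forall z : R[i], eigenvalue (map_mx (fun a : R => a%:C) M) z ->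
    complex.Re z <= 0.

Definition numerical_range n (M : 'M[R]_n) : set R[i] :=
  [set z | exists2 x : 'cV[R[i]]_n,
     Num.sqrt (\sum_i Normc.normc (x i 0) ^+ 2) = 1 &
     z = ((map_mx (@conjc R) x)^T *m map_mx (fun a : R => a%:C) M *m x) 0 0].

Definition open_left_half_plane : set R[i] := [set z | complex.Re z < 0].

(* Meant for symmetric matrices of positive size; then the set of real
   eigenvalues is finite and nonempty, and inf and sup are attained. *)
Definition lambda_min n (S : 'M[R]_n) : R := inf [set a | eigenvalue S a].
Definition lambda_max n (S : 'M[R]_n) : R := sup [set a | eigenvalue S a].

Definition frobenius_norm m n (M : 'M[R]_(m, n)) : R :=
  Num.sqrt (\sum_i \sum_j M i j ^+ 2).

Definition euclidean_norm n (x : 'cV[R]_n) : R :=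
  Num.sqrt (\sum_i x i 0 ^+ 2).

Definition spectral_norm n (M : 'M[R]_n) : R :=
  sup [set euclidean_norm (M *m x) | x in [set x | euclidean_norm x = 1]].

Definition cond2 n (M : 'M[R]_n) : R :=
  spectral_norm M * spectral_norm (invmx M).

(* Column stacking: entry (i, j) sits at position j * n + i. *)
Definition vec n (X : 'M[R]_n) : 'cV[R]_(n * n) :=
  \col_k X (mxtens_unindex k).2 (mxtens_unindex k).1.

Definition krylov N (M : 'M[R]_N) (b : 'cV[R]_N) (m : nat) : set 'cV[R]_N :=
  [set x | exists c : 'I_m -> R, x = \sum_(i < m) c i *: iter i (mulmx M) b].

(* [x] is the [m]-th GMRES iterate for [M x = b] with zero initial guess. *)
Definition gmres_iterate N (M : 'M[R]_N) (b : 'cV[R]_N) (m : nat)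
    (x : 'cV[R]_N) :=
  krylov M b m x /\
  forall y, krylov M b m y ->
    euclidean_norm (b - M *m x) <= euclidean_norm (b - M *m y).

End MatrixNotions.

Section Riccati.
Variables (R : realType) (n : nat).
Implicit Types A F L Q X : 'M[R]_n.

Definition riccati A F Q X : 'M[R]_n :=
  A^T *m X + X *m A - X *m F *m X + Q.

Definition closed_loop A F X : 'M[R]_n := A - F *m X.

Definition stabilizing_solution A F Q X :=
  [/\ sym_pos_semidef X, riccati A F Q X = 0, stable (closed_loop A F X) &
      forall Y, sym_pos_semidef Y -> riccati A F Q Y = 0 -> Y = X].

(* Matrix of [X |-> M^T X + X M] for column stacking (see [vec_lyapunov]).
   Since vec (B X C) = (C^T *t B) vec X, the second summand is M^T *t 1.  The
   form 1 *t M^T + M *t 1 is the same map only if C *t B denotes X |-> B X C;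
   with the Kronecker product of matrices it would be X |-> M^T X + X M^T. *)
Definition lyapunov_mx (M : 'M[R]_n) : 'M[R]_(n * n) :=
  1%:M *t M^T + M^T *t 1%:M.

(* Congruence X |-> L^T X L turns the Lyapunov operator of [M] into the one of
   [L^-1 M L] (see [scaled_lyapunov_mxE]).  The first Kronecker factors are
   transposed for the same reason as in [lyapunov_mx]. *)
Definition scaled_lyapunov_mx L (M : 'M[R]_n) : 'M[R]_(n * n) :=
  (L^T *t L^T) *m lyapunov_mx M *m ((invmx L)^T *t (invmx L)^T).

(* Lower bound on the GMRES iteration count.  It comes from
     |r_m| <= (1 - lambda_min((N + N^T)/2)^2 / lambda_max(N N^T))^(m/2) |r_0|,
   valid for (N + N^T)/2 positive definite.  The scaled Lyapunov matrix is
   negative definite, so the estimate is used for its opposite: [lambda_min] is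
   applied to the positive definite matrix - (Lk + Lk^T)/2, i.e. the eigenvalue
   of (Lk + Lk^T)/2 of smallest modulus enters.
   If the quotient is 1 (Lk is then a scalar matrix), [ln 0 = 0] and
   [x / 0 = 0] make the bound 0, its limit for log 0 = -oo. *)
Definition gmres_count_bound A F L Q X : R :=
  let Lk := scaled_lyapunov_mx L (closed_loop A F X) in
  - 2 * ln ((1 + Num.sqrt 2) *
            (cond2 F * frobenius_norm (X *m F *m X + Q) / lambda_min Q))
  / ln (1 - lambda_min (- (2^-1 *: (Lk + Lk^T))) ^+ 2 / lambda_max (Lk *m Lk^T)).

(* [Xhat k] is the matrix called hat X_(k+1): the one computed from [X k]. *)
Definition inexact_newton_kleinman A F Q (alpha : R)
    (X Xhat : nat -> 'M[R]_n) (it : nat -> nat) (lam : nat -> R) :=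
  forall k,
  [/\ gmres_iterate (lyapunov_mx (closed_loop A F (X k)))
        (- vec (X k *m F *m X k + Q)) (it k) (vec (Xhat k)),
      0 < lam k < 1,
      X k.+1 = (1 - lam k) *: X k + lam k *: Xhat k &
      spectral_norm (riccati A F Q ((1 - lam k) *: X k + lam k *: Xhat k))
        <= (1 - lam k * alpha) * spectral_norm (riccati A F Q (X k))].

Lemma vec_lyapunov (M X : 'M[R]_n) :
  lyapunov_mx M *m vec X = vec (M^T *m X + X *m M).
Proof.
apply/colP => k; rewrite /lyapunov_mx mulmxDl.
case: (mxtens_indexP k) => j i.
rewrite !mxE mxtens_indexK /=.
have reidx (G : 'I_(n * n) -> R) :
    \sum_k G k = \sum_a \sum_b G (mxtens_index (a, b)).
  rewrite pair_big /= (reindex (@mxtens_index n n)) /=.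
    by apply: eq_bigr => -[].
  by exists (@mxtens_unindex n n) => ? _; rewrite (mxtens_indexK, mxtens_unindexK).
congr (_ + _); rewrite reidx.
- rewrite (bigD1 j) //= [X in _ + X]big1 ?addr0 => [|a /negPf ja].
    by apply: eq_bigr => b _; rewrite !mxE !mxtens_indexK /= eqxx mul1r.
  apply: big1 => b _; rewrite !mxE !mxtens_indexK /=.
  by rewrite eq_sym ja !mul0r.
- apply: eq_bigr => a _.
  rewrite (bigD1 i) //= [X in _ + X]big1 ?addr0 => [|b /negPf ib].
    by rewrite !mxE !mxtens_indexK /= eqxx mulr1 mulrC.
  rewrite !mxE !mxtens_indexK /=.
  by rewrite eq_sym ib mulr0 mul0r.
Qed.

Lemma scaled_lyapunov_mxE L M : L \in unitmx ->
  scaled_lyapunov_mx L M = lyapunov_mx (invmx L *m M *m L).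
Proof.
move=> uL; rewrite /scaled_lyapunov_mx /lyapunov_mx mulmxDr mulmxDl.
rewrite !tensmx_mul !mulmx1 -!trmx_mul mulVmx // trmx1.
by rewrite !mulmxA.
Qed.

End Riccati.

(* Main.v *)
(* Write |.| for the Frobenius norm, <.,.> for its inner product, B = L^-1 A L and
   Y = L^T X L; the closed loop matrix A - F X is similar to B - Y.  The numerical range
   hypothesis yields c > 0 with <x, B x> <= - c |x|^2, an estimate inherited by B - Y as
   soon as X is positive semidefinite.

   The residual of the k-th Lyapunov equation is smaller than lambda_min(Q): GMRES does
   at least as well as the polynomial (1 + w z)^m, which contracts the scaled Lyapunov
   operator for w = mu / Lambda (Elman's bound).  So Xhat_k solves a Lyapunov equation
   with negative definite right-hand side, and an eigenvector of a negative eigenvalue of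
   L^T Xhat_k L would contradict the dissipativity of B - Y.  Hence every X_k is positive
   semidefinite.

   The line search makes |R(X_k)| decay geometrically.  For positive semidefinite X1, X2
   and E = Y1 - Y2 one has (B - Y1)^T E + E (B - Y2) = L^T (R(X1) - R(X2)) L, and pairing
   with E gives 2 c |E| <= |L^T (R(X1) - R(X2)) L|.  This estimate shows at once that
   (X_k) is Cauchy and that the positive semidefinite solution is unique. *)
Require Import Defs.
From mathcomp Require Import all_boot all_order all_algebra.
From mathcomp Require Import complex mxtens ring lra.
From mathcomp Require Import all_classical all_reals all_analysis.
Import Order.TTheory GRing.Theory Num.Theory.
Import numFieldNormedType.Exports.
Local Open Scope classical_set_scope.
Local Open Scope ring_scope.

(** * The Frobenius inner product and its Cauchy-Schwarz inequalities *)

Section FrobeniusProduct.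
Set Implicit Arguments.
Unset Strict Implicit.
Variable R : realType.

(** Kept rectangular so that column vectors and matrices share one inner product, which [vec]
    preserves. *)
Definition fdot m n (X Y : 'M[R]_(m, n)) : R := \tr (X^T *m Y).

Lemma fdotE m n (X Y : 'M[R]_(m, n)) : fdot X Y = \sum_j \sum_i X i j * Y i j.
Proof.
by apply: eq_bigr => j _; rewrite mxE; apply: eq_bigr => i _; rewrite mxE.
Qed.

Lemma fdotC m n (X Y : 'M[R]_(m, n)) : fdot X Y = fdot Y X.
Proof. by rewrite /fdot -mxtrace_tr trmx_mul trmxK. Qed.

Lemma fdotDr m n (X Y Z : 'M[R]_(m, n)) : fdot X (Y + Z) = fdot X Y + fdot X Z.
Proof. by rewrite /fdot mulmxDr mxtraceD. Qed.

Lemma fdotZr m n a (X Y : 'M[R]_(m, n)) : fdot X (a *: Y) = a * fdot X Y.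
Proof. by rewrite /fdot -scalemxAr mxtraceZ. Qed.

Lemma fdotNr m n (X Y : 'M[R]_(m, n)) : fdot X (- Y) = - fdot X Y.
Proof. by rewrite -scaleN1r fdotZr mulN1r. Qed.

Lemma fdotDl m n (X Y Z : 'M[R]_(m, n)) : fdot (X + Y) Z = fdot X Z + fdot Y Z.
Proof. by rewrite fdotC fdotDr !(fdotC Z). Qed.

Lemma fdotZl m n a (X Y : 'M[R]_(m, n)) : fdot (a *: X) Y = a * fdot X Y.
Proof. by rewrite fdotC fdotZr fdotC. Qed.

Lemma fdotNl m n (X Y : 'M[R]_(m, n)) : fdot (- X) Y = - fdot X Y.
Proof. by rewrite fdotC fdotNr fdotC. Qed.

Lemma fdot_trmx m n (X Y : 'M[R]_(m, n)) : fdot X^T Y^T = fdot X Y.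
Proof. by rewrite /fdot -trmx_mul mxtrace_tr mxtrace_mulC. Qed.

Lemma fdot_mull m p n (A : 'M[R]_(m, p)) (X : 'M[R]_(p, n)) (Y : 'M[R]_(m, n)) :
  fdot (A *m X) Y = fdot X (A^T *m Y).
Proof. by rewrite /fdot trmx_mul mulmxA. Qed.

Lemma fdot_ge0 m n (X : 'M[R]_(m, n)) : 0 <= fdot X X.
Proof.
by rewrite fdotE; apply: sumr_ge0 => j _; apply: sumr_ge0 => i _; rewrite -expr2 sqr_ge0.
Qed.

Lemma sqr_entry_le_fdot m n (X : 'M[R]_(m, n)) i j : X i j ^+ 2 <= fdot X X.
Proof.
rewrite fdotE (bigD1 j) //= (bigD1 i) //= -expr2 -addrA lerDl.
by apply: addr_ge0; apply: sumr_ge0 => k _; rewrite -?expr2 ?sqr_ge0 //;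
  apply: sumr_ge0 => l _; rewrite -expr2 sqr_ge0.
Qed.

Lemma fdot_eq0 m n (X : 'M[R]_(m, n)) : (fdot X X == 0) = (X == 0).
Proof.
apply/eqP/eqP => [X0|->]; last by rewrite /fdot mulmx0 mxtrace0.
apply/matrixP => i j; rewrite mxE; apply/eqP; rewrite -sqrf_eq0 eq_le sqr_ge0 -X0.
by rewrite sqr_entry_le_fdot.
Qed.

Lemma fdot_gt0 m n (X : 'M[R]_(m, n)) : (0 < fdot X X) = (X != 0).
Proof. by rewrite lt_def fdot_ge0 andbT fdot_eq0. Qed.

Lemma fdot_cV n (x : 'cV[R]_n) (S : 'M[R]_n) : (x^T *m S *m x) 0 0 = fdot x (S *m x).
Proof. by rewrite /fdot mulmxA /mxtrace big_ord1. Qed.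

Lemma fdot_cols m n (X Y : 'M[R]_(m, n)) : fdot X Y = \sum_j fdot (col j X) (col j Y).
Proof.
rewrite fdotE; apply: eq_bigr => j _; rewrite fdotE big_ord1.
by apply: eq_bigr => i _; rewrite !mxE.
Qed.

Lemma col_mulmx m p n (A : 'M[R]_(m, p)) (X : 'M[R]_(p, n)) j :
  col j (A *m X) = A *m col j X.
Proof. by rewrite !colE mulmxA. Qed.

Lemma frobenius_normE m n (X : 'M[R]_(m, n)) : frobenius_norm X = Num.sqrt (fdot X X).
Proof. by rewrite fdotE exchange_big. Qed.

Lemma sqr_frobenius_norm m n (X : 'M[R]_(m, n)) : frobenius_norm X ^+ 2 = fdot X X.
Proof. by rewrite frobenius_normE sqr_sqrtr ?fdot_ge0. Qed.

Lemma frobenius_norm_ge0 m n (X : 'M[R]_(m, n)) : 0 <= frobenius_norm X.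
Proof. by rewrite frobenius_normE sqrtr_ge0. Qed.

Lemma euclidean_normE n (x : 'cV[R]_n) : euclidean_norm x = frobenius_norm x.
Proof. by congr Num.sqrt; apply: eq_bigr => i _; rewrite big_ord1. Qed.

Lemma frobenius_norm_eq0 m n (X : 'M[R]_(m, n)) : (frobenius_norm X == 0) = (X == 0).
Proof. by rewrite -sqrf_eq0 sqr_frobenius_norm fdot_eq0. Qed.

Definition psd n (S : 'M[R]_n) := S^T = S /\ forall x : 'cV[R]_n, 0 <= fdot x (S *m x).

Lemma sym_pos_semidefE n (S : 'M[R]_n) : sym_pos_semidef S <-> psd S.
Proof.
by split=> -[h1 h2]; split=> // x; have := h2 x; rewrite fdot_cV.
Qed.

Lemma psd_cauchy_schwarz n p (S : 'M[R]_n) (X Y : 'M[R]_(n, p)) :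
  S^T = S -> (forall Z : 'M[R]_(n, p), 0 <= fdot Z (S *m Z)) ->
  fdot X (S *m Y) ^+ 2 <= fdot X (S *m X) * fdot Y (S *m Y).
Proof.
move=> symS S0.
set a := fdot X _; set b := fdot X _; set c := fdot Y _.
have quad s t : 0 <= s ^+ 2 * b + 2 * s * t * a + t ^+ 2 * c.
  have := S0 (s *: X + t *: Y).
  rewrite mulmxDr -!scalemxAr !(fdotDl, fdotDr, fdotZl, fdotZr).
  rewrite [fdot Y (S *m X)]fdotC fdot_mull symS -/a -/b -/c; congr (0 <= _); ring.
have b0 : 0 <= b by exact: S0.
(* For b > 0 the weights (-a, b) give b (b c - a^2) >= 0. For b = 0 the weights (c, -a) and (1, -a)
   give c a^2 <= 0 and 2 a^2 <= c a^2, hence a = 0. *)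
have := quad c (- a); have := quad 1 (- a); have := quad (- a) b.
have c0 : 0 <= c by exact: S0.
move: b0; rewrite le_eqVlt => /predU1P[b0|b0] h1 h2 h3; nra.
Qed.

Lemma cauchy_schwarz m n (X Y : 'M[R]_(m, n)) : fdot X Y ^+ 2 <= fdot X X * fdot Y Y.
Proof.
have := @psd_cauchy_schwarz _ _ 1%:M X Y (trmx1 _ _).
by rewrite !mul1mx; apply => Z; rewrite mul1mx fdot_ge0.
Qed.

Lemma fdot_le_frobenius m n (X Y : 'M[R]_(m, n)) :
  fdot X Y <= frobenius_norm X * frobenius_norm Y.
Proof.
rewrite (le_trans (ler_norm _)) // -sqrtr_sqr !frobenius_normE -sqrtrM ?fdot_ge0 //.
by rewrite ler_wsqrtr // cauchy_schwarz.
Qed.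

Lemma frobenius_normD m n (X Y : 'M[R]_(m, n)) :
  frobenius_norm (X + Y) <= frobenius_norm X + frobenius_norm Y.
Proof.
rewrite -(@ler_pXn2r _ 2) ?nnegrE ?addr_ge0 ?frobenius_norm_ge0 //.
rewrite sqr_frobenius_norm fdotDl !fdotDr (fdotC Y X) sqrrD !sqr_frobenius_norm.
have := fdot_le_frobenius X Y; lra.
Qed.

Lemma frobenius_normN m n (X : 'M[R]_(m, n)) : frobenius_norm (- X) = frobenius_norm X.
Proof. by rewrite !frobenius_normE fdotNl fdotNr opprK. Qed.

Lemma fdot_mulmx_le m p n (A : 'M[R]_(m, p)) c :
  (forall x : 'cV_p, fdot (A *m x) (A *m x) <= c * fdot x x) ->
  forall X : 'M[R]_(p, n), fdot (A *m X) (A *m X) <= c * fdot X X.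
Proof.
move=> h X; rewrite !fdot_cols mulr_sumr; apply: ler_sum => j _.
by rewrite col_mulmx h.
Qed.

Lemma fdot_form_le m n (A : 'M[R]_m) c :
  (forall x : 'cV_m, fdot x (A *m x) <= c * fdot x x) ->
  forall X : 'M[R]_(m, n), fdot X (A *m X) <= c * fdot X X.
Proof.
move=> h X; rewrite !fdot_cols mulr_sumr; apply: ler_sum => j _.
by rewrite col_mulmx h.
Qed.

(** |A^T x|^2 = <x, A A^T x> <= |x| |A A^T x| <= sqrt c |x| |A^T x|: a matrix and its transpose have
    the same operator norm. *)
Lemma fdot_trmx_mulmx_le m n (A : 'M[R]_(m, n)) c : 0 <= c ->
  (forall x : 'cV_n, fdot (A *m x) (A *m x) <= c * fdot x x) ->
  forall x : 'cV_m, fdot (A^T *m x) (A^T *m x) <= c * fdot x x.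
Proof.
move=> c0 h x; set y := A^T *m x.
have h1 : fdot y y = fdot x (A *m y) by rewrite {1}/y fdot_mull trmxK.
have := cauchy_schwarz x (A *m y); rewrite -h1.
have := h y; have := fdot_ge0 x; have := fdot_ge0 y.
rewrite le_eqVlt => /predU1P[<- x0 _ _|]; first by rewrite mulr_ge0.
by nra.
Qed.

Lemma fdot_mulmx_le_frobenius m p n (A : 'M[R]_(m, p)) (X : 'M[R]_(p, n)) :
  fdot (A *m X) (A *m X) <= fdot A A * fdot X X.
Proof.
apply: fdot_mulmx_le => x; rewrite -(fdot_trmx A A).
rewrite [in leRHS]fdot_cols mulr_suml fdotE big_ord1.
apply: ler_sum => i _; rewrite -expr2.
have -> : (A *m x) i 0 = fdot (col i A^T) x.
  by rewrite fdotE big_ord1 mxE; apply: eq_bigr => j _; rewrite !mxE.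
exact: cauchy_schwarz.
Qed.

Lemma fdot_form_le_frobenius n p (A : 'M[R]_n) (X : 'M[R]_(n, p)) :
  fdot X (A *m X) <= frobenius_norm A * fdot X X.
Proof.
rewrite (le_trans (fdot_le_frobenius _ _)) // -(sqr_frobenius_norm X) expr2 mulrA.
rewrite mulrC ler_wpM2r ?frobenius_norm_ge0 // [leRHS]mulrC [leRHS]mulrC.
rewrite -(@ler_pXn2r _ 2) ?nnegrE ?mulr_ge0 ?frobenius_norm_ge0 //.
by rewrite exprMn !sqr_frobenius_norm fdot_mulmx_le_frobenius.
Qed.

End FrobeniusProduct.

(** * Extremal eigenvalues, dissipativity and the spectral norm *)

Section ExtremalEigenvalues.
Set Implicit Arguments.
Unset Strict Implicit.
Variable R : realType.

(** Two bounds combine: |S x|^2 <= |S| <x, S x>, from Cauchy-Schwarz for the form of S, and |x|^2 <=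
    |S^-1|^2 |S x|^2. The summand 1 in [K] makes it positive. *)
Lemma psd_unit_coercive n (S : 'M[R]_n) : psd S -> S \in unitmx ->
  exists2 d, 0 < d & forall x : 'cV_n, d * fdot x x <= fdot x (S *m x).
Proof.
move=> [symS S0] uS.
set K := fdot (invmx S) (invmx S) * frobenius_norm S + 1.
have K0 : 0 < K by rewrite ltr_pwDr // mulr_ge0 ?fdot_ge0 ?frobenius_norm_ge0.
exists K^-1; first by rewrite invr_gt0.
move=> x; rewrite ler_pdivrMl //.
have h1 : fdot (S *m x) (S *m x) <= frobenius_norm S * fdot x (S *m x).
  have := psd_cauchy_schwarz (S *m x) x symS S0.
  have := fdot_form_le_frobenius S (S *m x); have := S0 x.
  have := frobenius_norm_ge0 S; have := fdot_ge0 (S *m x).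
  rewrite le_eqVlt => /predU1P[<- f0 s0 _ _|]; first by rewrite mulr_ge0.
  by nra.
have := fdot_mulmx_le_frobenius (invmx S) (S *m x); rewrite mulKmx // => h2.
rewrite (le_trans h2) // /K mulrDl mul1r -mulrA.
by rewrite ler_wpDr ?S0 // ler_wpM2l ?fdot_ge0.
Qed.

(** The least Rayleigh quotient, obtained as the supremum of its lower bounds instead of by
    compactness of the sphere. *)
Lemma sym_min_eigenvector n (S : 'M[R]_n) : (0 < n)%N -> S^T = S ->
  exists mu (x : 'cV_n), [/\ x != 0, S *m x = mu *: x &
    forall y : 'cV_n, mu * fdot y y <= fdot y (S *m y)].
Proof.
move=> n0 symS.
pose D := [set a : R | forall y : 'cV_n, a * fdot y y <= fdot y (S *m y)].
have ubD (y : 'cV_n) : y != 0 -> ubound D (fdot y (S *m y) / fdot y y).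
  by move=> y0 a Da; rewrite ler_pdivlMr ?fdot_gt0.
have D0 : D !=set0.
  exists (- frobenius_norm S) => y.
  rewrite mulNr lerNl -fdotNr -mulNmx -(frobenius_normN S).
  exact: fdot_form_le_frobenius.
have e0 : const_mx 1 != 0 :> 'cV[R]_n.
  by apply/eqP => /colP /(_ (Ordinal n0)) /eqP; rewrite !mxE oner_eq0.
have supD : has_sup D by split=> //; eexists; exact: ubD e0.
have muD : D (sup D).
  move=> y; have [->|y0] := eqVneq y 0; first by rewrite mulmx0 /fdot mulmx0 mxtrace0 mulr0.
  rewrite -ler_pdivlMr ?fdot_gt0 //; apply: ge_sup => //; exact: ubD.
pose T := S - (sup D)%:M.
have TE (y : 'cV_n) : T *m y = S *m y - sup D *: y by rewrite mulmxBl mul_scalar_mx.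
have psdT : psd T.
  split=> [|y]; first by rewrite /T linearB /= symS tr_scalar_mx.
  by rewrite TE fdotDr fdotNr fdotZr subr_ge0; exact: muD.
(* If S - (sup D) I were invertible it would be coercive, and sup D could be increased. *)
have [uT|] := boolP (T \in unitmx).
  have [d d0 hd] := psd_unit_coercive psdT uT.
  suff : sup D + d <= sup D by rewrite gerDl leNgt d0.
  apply: sup_ubound => //; first by case: supD.
  by move=> y; have := hd y; rewrite TE fdotDr fdotNr fdotZr; lra.
rewrite unitmxE unitfE negbK => /det0P[v v0 vT].
exists (sup D), v^T; split => //; first by rewrite trmx_eq0.
apply/eqP; rewrite -subr_eq0 -TE; case: psdT => <- _.
by rewrite -trmx_mul vT trmx0.
Qed.

(** [eigenvalue] speaks of row eigenvectors; symmetry of S turns them into columns. *)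
Lemma sym_eigenvalueP n (S : 'M[R]_n) a : S^T = S ->
  eigenvalue S a <-> exists2 x : 'cV_n, x != 0 & S *m x = a *: x.
Proof.
move=> symS; split.
  case/eigenvalueP => v vS v0; exists v^T; first by rewrite trmx_eq0.
  by rewrite -[S in LHS]symS -trmx_mul vS linearZ.
case=> x x0 Sx; apply/eigenvalueP; exists x^T; last by rewrite trmx_eq0.
by rewrite -[S in LHS]symS -trmx_mul Sx linearZ.
Qed.

Lemma lambda_min_attained n (S : 'M[R]_n) : (0 < n)%N -> S^T = S ->
  exists2 x : 'cV_n, x != 0 & S *m x = lambda_min S *: x.
Proof.
move=> n0 symS; have [mu [x [x0 Sx mu_le]]] := sym_min_eigenvector n0 symS.
exists x => //; rewrite Sx; congr (_ *: _).
have lb : lbound [set a | eigenvalue S a] mu.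
  move=> a /(sym_eigenvalueP _ symS) [y y0 Sy].
  by have := mu_le y; rewrite Sy fdotZr ler_pM2r ?fdot_gt0.
have ex : eigenvalue S mu by apply/(sym_eigenvalueP _ symS); exists x.
apply/eqP; rewrite eq_le lb_le_inf /=; first last.
- by [].
- by exists mu.
by apply: ge_inf => //; exists mu.
Qed.

Lemma lambda_min_le n (S : 'M[R]_n) : (0 < n)%N -> S^T = S ->
  forall x : 'cV_n, lambda_min S * fdot x x <= fdot x (S *m x).
Proof.
move=> n0 symS; have [mu [x [x0 Sx mu_le]]] := sym_min_eigenvector n0 symS.
move=> y; apply: le_trans (mu_le y); rewrite ler_wpM2r ?fdot_ge0 //.
apply: ge_inf; last by apply/(sym_eigenvalueP _ symS); exists x.
exists mu => a /(sym_eigenvalueP _ symS) [z z0 Sz].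
by have := mu_le z; rewrite Sz fdotZr ler_pM2r ?fdot_gt0.
Qed.

Lemma lambda_max_ge n (S : 'M[R]_n) : (0 < n)%N -> S^T = S ->
  forall x : 'cV_n, fdot x (S *m x) <= lambda_max S * fdot x x.
Proof.
move=> n0 symS.
have symN : (- S)^T = - S by rewrite linearN /= symS.
have [mu [x [x0 Sx mu_le]]] := sym_min_eigenvector n0 symN.
have le_mu (y : 'cV_n) : fdot y (S *m y) <= - mu * fdot y y.
  by have := mu_le y; rewrite mulNmx fdotNr mulNr lerNr.
move=> y; apply: (le_trans (le_mu y)); rewrite ler_wpM2r ?fdot_ge0 //.
apply: ub_le_sup; last first.
  apply/(sym_eigenvalueP _ symS); exists x => //.
  by apply: oppr_inj; rewrite -mulNmx Sx scaleNr opprK.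
exists (- mu) => a /(sym_eigenvalueP _ symS) [z z0 Sz].
by have := le_mu z; rewrite Sz fdotZr ler_pM2r ?fdot_gt0.
Qed.

Lemma lambda_min_gt0 n (S : 'M[R]_n) : (0 < n)%N -> sym_pos_def S -> 0 < lambda_min S.
Proof.
move=> n0 [symS S0]; have [x x0 Sx] := lambda_min_attained n0 symS.
by have := S0 _ x0; rewrite fdot_cV Sx fdotZr pmulr_lgt0 ?fdot_gt0.
Qed.

Lemma fdot_sym_part n p (B : 'M[R]_n) (x : 'M[R]_(n, p)) :
  fdot x (- (2^-1 *: (B + B^T)) *m x) = - fdot x (B *m x).
Proof.
rewrite mulNmx fdotNr -scalemxAl fdotZr mulmxDl fdotDr.
rewrite -(fdot_mull B) (fdotC (B *m x)); congr (- _); lra.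
Qed.

Lemma sym_part_tr n (B : 'M[R]_n) : (- (2^-1 *: (B + B^T)))^T = - (2^-1 *: (B + B^T)).
Proof. by rewrite linearN linearZ /= linearD /= trmxK addrC. Qed.

(** Equivalently, the symmetric part of B has all its eigenvalues at most -c. *)
Definition dissipative n c (B : 'M[R]_n) :=
  forall x : 'cV_n, fdot x (B *m x) <= - c * fdot x x.

(** Real unit vectors already give <x, B x> < 0, so minus the symmetric part of B is positive
    definite, and its least eigenvalue serves as c. *)
Lemma numerical_range_dissipative n (B : 'M[R]_n) : (0 < n)%N ->
  numerical_range B `<=` @open_left_half_plane R ->
  exists2 c, 0 < c & dissipative c B.
Proof.
move=> n0 WB; pose S := - (2^-1 *: (B + B^T)).
have pdS : sym_pos_def S.
  split=> [|x x0]; first exact: sym_part_tr.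
  rewrite fdot_cV fdot_sym_part oppr_gt0.
  pose y := (frobenius_norm x)^-1 *: x.
  have fx : 0 < frobenius_norm x.
    by rewrite lt_def frobenius_norm_ge0 frobenius_norm_eq0 x0.
  suff : fdot y (B *m y) < 0.
    by rewrite /y -scalemxAr fdotZl fdotZr !pmulr_rlt0 ?invr_gt0.
  have /WB : numerical_range B (real_complex R (fdot y (B *m y))).
    exists (map_mx (real_complex R) y).
      transitivity (frobenius_norm y); last first.
        rewrite frobenius_normE fdotZl fdotZr -sqr_frobenius_norm mulrA -expr2 -exprMn.
        by rewrite mulVf ?gt_eqF // expr1n sqrtr1.
      rewrite -euclidean_normE; congr Num.sqrt; apply: eq_bigr => i _.
      by rewrite mxE /= expr0n addr0 sqrtr_sqr real_normK ?num_real.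
    have -> : map_mx (@conjc R) (map_mx (real_complex R) y) = map_mx (real_complex R) y.
      by apply/matrixP => i j; rewrite !mxE /= oppr0.
    by rewrite map_trmx -!map_mxM mxE fdot_cV.
  by [].
exists (lambda_min S); first exact: lambda_min_gt0.
by move=> x; have := lambda_min_le n0 (proj1 pdS) x; rewrite fdot_sym_part; lra.
Qed.

Lemma euclidean_norm_mulmx_le n (M : 'M[R]_n) (x : 'cV_n) :
  euclidean_norm (M *m x) <= spectral_norm M * euclidean_norm x.
Proof.
rewrite !euclidean_normE.
have [->|x0] := eqVneq x 0.
  by rewrite mulmx0 (eqP (_ : frobenius_norm 0 == 0)) ?frobenius_norm_eq0 ?mulr0.
have fx : 0 < frobenius_norm x.
  by rewrite lt_def frobenius_norm_ge0 frobenius_norm_eq0 x0.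
have frZ a m p (z : 'M[R]_(m, p)) : 0 <= a ->
    frobenius_norm (a *: z) = a * frobenius_norm z.
  move=> a0; rewrite !frobenius_normE fdotZl fdotZr mulrA -expr2 sqrtrM ?sqr_ge0 //.
  by rewrite sqrtr_sqr ger0_norm.
rewrite -ler_pdivrMr // mulrC -frZ ?invr_ge0 ?frobenius_norm_ge0 // scalemxAr.
rewrite -euclidean_normE.
apply: ub_le_sup; last first.
  exists ((frobenius_norm x)^-1 *: x) => //=.
  by rewrite euclidean_normE frZ ?invr_ge0 ?frobenius_norm_ge0 // mulVf ?gt_eqF.
(* The Frobenius norm bounds the set whose supremum defines [spectral_norm]. *)
exists (frobenius_norm M) => _ [y /= y1 <-].
rewrite !euclidean_normE in y1 *.
rewrite -(@ler_pXn2r _ 2) ?nnegrE ?frobenius_norm_ge0 //.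
rewrite -[leRHS]mulr1 -[X in _ * X](expr1n _ 2) -[1 in leRHS]y1.
by rewrite !sqr_frobenius_norm fdot_mulmx_le_frobenius.
Qed.

Lemma spectral_norm_ge0 n (M : 'M[R]_n) : (0 < n)%N -> 0 <= spectral_norm M.
Proof.
move=> n0; pose e : 'cV[R]_n := const_mx 1.
have e0 : 0 < euclidean_norm e.
  rewrite euclidean_normE lt_def frobenius_norm_ge0 frobenius_norm_eq0 andbT.
  by apply/eqP => /colP /(_ (Ordinal n0)) /eqP; rewrite !mxE oner_eq0.
rewrite -(pmulr_lge0 _ e0); apply: le_trans (euclidean_norm_mulmx_le M e).
by rewrite euclidean_normE frobenius_norm_ge0.
Qed.

Lemma fdot_mulmx_le_spectral m n (M : 'M[R]_m) (X : 'M[R]_(m, n)) :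
  fdot (M *m X) (M *m X) <= spectral_norm M ^+ 2 * fdot X X.
Proof.
apply: fdot_mulmx_le => x; rewrite -!sqr_frobenius_norm -exprMn -!euclidean_normE.
rewrite lerXn2r ?nnegrE ?euclidean_norm_mulmx_le ?euclidean_normE ?frobenius_norm_ge0 //.
rewrite -euclidean_normE (le_trans _ (euclidean_norm_mulmx_le M x)) //.
by rewrite euclidean_normE frobenius_norm_ge0.
Qed.

Lemma fdot_form_le_spectral m n (M : 'M[R]_m) (X : 'M[R]_(m, n)) :
  fdot X (M *m X) <= spectral_norm M * fdot X X.
Proof.
apply: fdot_form_le => x; rewrite (le_trans (fdot_le_frobenius _ _)) //.
rewrite -sqr_frobenius_norm expr2 mulrCA ler_wpM2l ?frobenius_norm_ge0 //.
by rewrite -!euclidean_normE euclidean_norm_mulmx_le.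
Qed.

(** M = M I, so the constant is |I|. The line search controls the spectral norm, while the
    perturbation estimates use the Frobenius norm. *)
Lemma frobenius_le_spectral n (M : 'M[R]_n) : (0 < n)%N ->
  frobenius_norm M <= spectral_norm M * frobenius_norm (1%:M : 'M[R]_n).
Proof.
move=> n0; have M0 := spectral_norm_ge0 M n0.
rewrite -(@ler_pXn2r _ 2) ?nnegrE ?mulr_ge0 ?frobenius_norm_ge0 //.
by rewrite exprMn !sqr_frobenius_norm -{1 2}[M]mulmx1 fdot_mulmx_le_spectral.
Qed.

End ExtremalEigenvalues.

(** * Lyapunov operators, Elman's contraction and GMRES residuals *)

Section Gmres.
Set Implicit Arguments.
Unset Strict Implicit.
Variable R : realType.

Lemma vecD n (X Y : 'M[R]_n) : vec (X + Y) = vec X + vec Y.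
Proof. by apply/colP => k; rewrite !mxE. Qed.

Lemma vecZ n a (X : 'M[R]_n) : vec (a *: X) = a *: vec X.
Proof. by apply/colP => k; rewrite !mxE. Qed.

Lemma vecN n (X : 'M[R]_n) : vec (- X) = - vec X.
Proof. by apply/colP => k; rewrite !mxE. Qed.

Lemma vec0 n : vec (0 : 'M[R]_n) = 0.
Proof. by apply/colP => k; rewrite !mxE. Qed.

Lemma vec_inj n : injective (@vec R n).
Proof.
move=> X Y /colP XY; apply/matrixP => i j.
by have := XY (mxtens_index (j, i)); rewrite !mxE mxtens_indexK.
Qed.

Lemma vec_surj n (v : 'cV[R]_(n * n)) : exists X : 'M[R]_n, v = vec X.
Proof.
exists (\matrix_(i, j) v (mxtens_index (j, i)) 0).
by apply/colP => k; rewrite !mxE -surjective_pairing mxtens_unindexK.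
Qed.

Lemma fdot_vec n (X Y : 'M[R]_n) : fdot (vec X) (vec Y) = fdot X Y.
Proof.
rewrite !fdotE big_ord1 pair_big /= (reindex (@mxtens_index n n)) /=.
  by apply: eq_bigr => -[i j] _; rewrite !mxE mxtens_indexK.
by exists (@mxtens_unindex n n) => ? _; rewrite (mxtens_indexK, mxtens_unindexK).
Qed.

Definition lyap n (M X : 'M[R]_n) := M^T *m X + X *m M.

(** <E, M1^T E> = <E, M1 E> is a sum over the columns of E, and <E, E M2> = <E^T, M2 E^T> one over
    the columns of E^T. Two matrices are allowed because a difference of Riccati residuals involves
    two closed loops. *)
Lemma fdot_sylvester n c (M1 M2 E : 'M[R]_n) :
  dissipative c M1 -> dissipative c M2 ->
  fdot E (M1^T *m E + E *m M2) <= - (2 * c) * fdot E E.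
Proof.
move=> d1 d2; rewrite fdotDr -fdot_mull fdotC.
rewrite -[in fdot E (E *m M2)]fdot_trmx trmx_mul -fdot_mull [fdot (_ *m E^T) _]fdotC.
have := fdot_form_le d1 E; have := fdot_form_le d2 E^T; rewrite fdot_trmx; lra.
Qed.

Lemma congruenceK n (L X : 'M[R]_n) : L \in unitmx ->
  (invmx L)^T *m (L^T *m X *m L) *m invmx L = X.
Proof.
move=> uL; rewrite !mulmxA -trmx_mul mulmxV // trmx1 mul1mx.
by rewrite -mulmxA mulmxV // mulmx1.
Qed.

Lemma sylvester_congruence n (L M1 M2 X : 'M[R]_n) : L \in unitmx ->
  L^T *m (M1^T *m X + X *m M2) *m L =
  (invmx L *m M1 *m L)^T *m (L^T *m X *m L) + (L^T *m X *m L) *m (invmx L *m M2 *m L).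
Proof.
move=> uL; rewrite mulmxDr mulmxDl !trmx_mul !mulmxA.
congr (_ + _); last by rewrite mulmxK.
rewrite -!mulmxA; congr (_ *m (_ *m _)).
by rewrite mulmxA -trmx_mul mulmxV // trmx1 mul1mx.
Qed.

Lemma lyap_congruence n (L M X : 'M[R]_n) : L \in unitmx ->
  L^T *m lyap M X *m L = lyap (invmx L *m M *m L) (L^T *m X *m L).
Proof. exact: sylvester_congruence. Qed.

(** |x + w H x|^2 <= (1 - 2 w mu + w^2 Lam) |x|^2, and w = mu / Lam minimizes this factor, with
    minimum q. *)
Lemma elman_contraction N (H : 'M[R]_N) : (0 < N)%N ->
  let mu := lambda_min (- (2^-1 *: (H + H^T))) in
  let Lam := lambda_max (H *m H^T) in
  let q := 1 - mu ^+ 2 / Lam in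
  0 < mu ->
  [/\ 0 <= q, q < 1 & forall x : 'cV_N,
    fdot (x + (mu / Lam) *: (H *m x)) (x + (mu / Lam) *: (H *m x)) <= q * fdot x x].
Proof.
move=> N0 mu Lam q mu0.
have muH (x : 'cV_N) : mu * fdot x x <= - fdot x (H *m x).
  by rewrite -fdot_sym_part lambda_min_le // sym_part_tr.
have symHH : (H *m H^T)^T = H *m H^T by rewrite trmx_mul trmxK.
have LamHT (x : 'cV_N) : fdot (H^T *m x) (H^T *m x) <= Lam * fdot x x.
  by rewrite fdot_mull trmxK mulmxA lambda_max_ge.
have [e e0] : exists e : 'cV[R]_N, 0 < fdot e e.
  exists (const_mx 1); rewrite fdot_gt0.
  by apply/eqP => /colP /(_ (Ordinal N0)) /eqP; rewrite !mxE oner_eq0.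
have Lam_ge0 : 0 <= Lam.
  by rewrite -(pmulr_lge0 _ e0) (le_trans _ (LamHT e)) ?fdot_ge0.
have LamH (x : 'cV_N) : fdot (H *m x) (H *m x) <= Lam * fdot x x.
  by have := fdot_trmx_mulmx_le Lam_ge0 LamHT x; rewrite trmxK.
(* mu |e|^2 <= - <e, H e> <= |e| |H e| <= sqrt Lam |e|^2 for the test vector e; this yields both Lam
   > 0 and q >= 0. *)
have mu2 : mu ^+ 2 <= Lam.
  have := cauchy_schwarz e (H *m e); have := LamH e; have := muH e; move: e0.
  set a := fdot e e; set b := fdot e _; set d := fdot (H *m e) _ => a0 hb hd cs.
  have : (mu * a) ^+ 2 <= Lam * a ^+ 2.
    apply: (@le_trans _ _ (b ^+ 2)).
      by rewrite -(sqrrN b) lerXn2r ?nnegrE ?mulr_ge0 //; nra.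
    by rewrite (le_trans cs) // expr2 mulrCA ler_pM2l.
  by rewrite exprMn ler_pM2r // exprn_gt0.
have Lam0 : 0 < Lam by apply: lt_le_trans mu2; rewrite exprn_gt0.
split.
- by rewrite subr_ge0 ler_pdivrMr // mul1r.
- by rewrite gtrBl divr_gt0 // exprn_gt0.
move=> x; rewrite !(fdotDl, fdotDr, fdotZl, fdotZr) [fdot (H *m x) x]fdotC.
have h1 := muH x; have h2 := LamH x.
have w0 : 0 < mu / Lam by rewrite divr_gt0.
have -> : q = 1 - 2 * (mu / Lam) * mu + (mu / Lam) ^+ 2 * Lam.
  by rewrite /q; field; rewrite gt_eqF.
have := ler_wpM2l (ltW w0) h1; have := ler_wpM2l (sqr_ge0 (mu / Lam)) h2.
move: (mu / Lam) (fdot x x) (fdot _ _) (fdot _ _) => w a b d; nra.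
Qed.

(** * Krylov subspaces and an explicit competitor of the GMRES iterate *)

Section Krylov.
Variables (N : nat) (H : 'M[R]_N) (b : 'cV[R]_N).

Lemma krylovD m x y : krylov H b m x -> krylov H b m y -> krylov H b m (x + y).
Proof.
move=> [c ->] [d ->]; exists (fun i => c i + d i); rewrite -big_split /=.
by apply: eq_bigr => i _; rewrite scalerDl.
Qed.

Lemma krylovZ m a x : krylov H b m x -> krylov H b m (a *: x).
Proof.
move=> [c ->]; exists (fun i => a * c i); rewrite scaler_sumr.
by apply: eq_bigr => i _; rewrite scalerA.
Qed.

Lemma krylov_succ m x : krylov H b m x -> krylov H b m.+1 x.
Proof.
move=> [c ->]; exists (fun i => if unlift ord_max i is Some j then c j else 0).
rewrite big_ord_recr /= unlift_none scale0r addr0; apply: eq_bigr => i _.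
have -> : widen_ord (leqnSn m) i = lift ord_max i.
  by apply: val_inj; rewrite /= /bump leqNgt ltn_ord.
by rewrite liftK.
Qed.

Lemma krylov_rhs m : krylov H b m.+1 b.
Proof.
exists (fun i => (i == ord0)%:R).
rewrite big_ord_recl eqxx scale1r /= big1 ?addr0 // => i _.
by rewrite scale0r.
Qed.

Lemma krylov_mul m x : krylov H b m x -> krylov H b m.+1 (H *m x).
Proof.
move=> [c ->]; exists (fun i => if unlift ord0 i is Some j then c j else 0).
rewrite big_ord_recl unlift_none scale0r add0r mulmx_sumr; apply: eq_bigr => i _.
by rewrite liftK -scalemxAr /=.
Qed.

(** Multiplication by 1 + w H, the effect of a Richardson step on the residual. *)
Definition richardson w (v : 'cV[R]_N) := v + w *: (H *m v).

(* The polynomial (1 + w z)^m takes the value 1 at 0, so its value at H, applied to b,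
   is the residual of an admissible competitor of the GMRES iterate. *)
Lemma richardson_krylov w m :
  exists2 y, krylov H b m y & iter m (richardson w) b = b - H *m y.
Proof.
elim: m => [|m [y Ky IH]].
  exists 0; last by rewrite mulmx0 subr0.
  by exists (fun=> 0); rewrite big_ord0.
(* The new point y - w (b - H y) has residual (1 + w H) (b - H y). *)
exists (y + (- w) *: b + w *: (H *m y)).
  apply: krylovD; [apply: krylovD|]; first exact: krylov_succ.
    by apply/krylovZ/krylov_rhs.
  exact/krylovZ/krylov_mul.
rewrite iterS IH /richardson !mulmxDr mulmxN -!scalemxAr.
by apply/colP => i; rewrite !mxE; ring.
Qed.

Lemma gmres_residual_le w m x : gmres_iterate H b m x ->
  fdot (b - H *m x) (b - H *m x) <=
  fdot (iter m (richardson w) b) (iter m (richardson w) b).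
Proof.
case=> _ opt; have [y Ky ->] := richardson_krylov w m.
have := opt _ Ky; rewrite !euclidean_normE -!sqr_frobenius_norm.
by move=> h; rewrite lerXn2r ?nnegrE ?frobenius_norm_ge0.
Qed.

End Krylov.

(** Symmetric matrices form a subspace that contains C and is invariant under the Lyapunov operator,
    so it contains the whole Krylov space. *)
Lemma gmres_iterate_sym n (M C Z : 'M[R]_n) m : C^T = C ->
  gmres_iterate (lyapunov_mx M) (- vec C) m (vec Z) -> Z^T = Z.
Proof.
move=> symC [[c Zc] _].
pose symvec v := exists2 Y : 'M[R]_n, Y^T = Y & v = vec Y.
suff [Y symY /vec_inj->//] : symvec (vec Z).
rewrite Zc; apply: big_ind => [|x y [X sX ->] [Y sY ->]|i _].
- by exists 0; rewrite ?trmx0 ?vec0.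
- by exists (X + Y); rewrite ?vecD // linearD /= sX sY.
have [Y sY ->] : symvec (iter i (mulmx (lyapunov_mx M)) (- vec C)).
  elim: {+}(i : nat) => [|k IH].
    by exists (- C); rewrite ?vecN // linearN /= symC.
  rewrite iterS; case: IH => Y sY ->.
  exists (M^T *m Y + Y *m M); last by rewrite vec_lyapunov.
  by rewrite linearD /= !trmx_mul trmxK sY addrC.
by exists (c i *: Y); rewrite ?vecZ // linearZ /= sY.
Qed.

Definition richardson_lyap n w (M X : 'M[R]_n) := X + w *: lyap M X.

Lemma richardson_vec n w (M X : 'M[R]_n) m :
  iter m (richardson (lyapunov_mx M) w) (vec X) = vec (iter m (richardson_lyap w M) X).
Proof.
by elim: m => //= m ->; rewrite /richardson /richardson_lyap vecD vecZ vec_lyapunov.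
Qed.

(** GMRES runs on the unscaled system; congruence turns a polynomial in the Lyapunov operator of M
    into the same polynomial in that of L^-1 M L, to which Elman's contraction applies. *)
Lemma richardson_congruence n w (L M X : 'M[R]_n) m : L \in unitmx ->
  L^T *m iter m (richardson_lyap w M) X *m L =
  iter m (richardson_lyap w (invmx L *m M *m L)) (L^T *m X *m L).
Proof.
move=> uL; elim: m => //= m <-; rewrite /richardson_lyap mulmxDr mulmxDl.
by rewrite -scalemxAr -scalemxAl lyap_congruence.
Qed.

Lemma iter_contraction N (H : 'M[R]_N) w q m : 0 <= q ->
  (forall x : 'cV_N, fdot (richardson H w x) (richardson H w x) <= q * fdot x x) ->
  forall x : 'cV_N,
    fdot (iter m (richardson H w) x) (iter m (richardson H w) x) <= q ^+ m * fdot x x.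
Proof.
move=> q0 h x; elim: m => [|m IH]; first by rewrite expr0 mul1r.
by rewrite iterS (le_trans (h _)) // exprS -mulrA ler_wpM2l.
Qed.

(** The constant c bounds a squared norm and enters once for each side of the congruence. *)
Lemma fdot_congruence_le n c (P X : 'M[R]_n) : 0 <= c ->
  (forall x : 'cV_n, fdot (P^T *m x) (P^T *m x) <= c * fdot x x) ->
  fdot (P^T *m X *m P) (P^T *m X *m P) <= c ^+ 2 * fdot X X.
Proof.
move=> c0 h; rewrite -fdot_trmx !trmx_mul trmxK.
rewrite (le_trans (fdot_mulmx_le h _)) // expr2 -mulrA ler_wpM2l //.
by rewrite -(fdot_trmx _ (X^T *m P)) !trmx_mul trmxK fdot_mulmx_le.
Qed.

Lemma cholesky_unit n (F L : 'M[R]_n) : cholesky_factor F L -> L \in unitmx.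
Proof.
case=> tL dL _; rewrite unitmxE unitfE det_trig //.
by apply/prodf_neq0 => i _; rewrite gt_eqF.
Qed.

Lemma fdot_congruence_factor n (F L X : 'M[R]_n) : (0 < n)%N -> F = L *m L^T ->
  fdot (L^T *m X *m L) (L^T *m X *m L) <= spectral_norm F ^+ 2 * fdot X X.
Proof.
move=> n0 ->; apply: fdot_congruence_le => [|x]; first exact: spectral_norm_ge0.
by rewrite fdot_mull trmxK mulmxA fdot_form_le_spectral.
Qed.

(** F^-1 = L^-T L^-1 gives |L^-1 x|^2 = <x, F^-1 x>; transposition yields the bound for L^-T that
    the congruence estimate asks for. *)
Lemma fdot_congruence_invfactor n (F L X : 'M[R]_n) : (0 < n)%N -> L \in unitmx ->
  F = L *m L^T ->
  fdot ((invmx L)^T *m X *m invmx L) ((invmx L)^T *m X *m invmx L) <=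
  spectral_norm (invmx F) ^+ 2 * fdot X X.
Proof.
move=> n0 uL FE; have s0 := spectral_norm_ge0 (invmx F) n0.
apply: fdot_congruence_le => //; apply: fdot_trmx_mulmx_le => // x.
have -> : invmx F = (invmx L)^T *m invmx L.
  have uF : F \in unitmx by rewrite FE unitmx_mul unitmx_tr uL.
  apply: (can_inj (mulKmx uF)); rewrite mulmxV // FE mulmxA -(mulmxA L) -trmx_mul mulVmx //.
  by rewrite trmx1 mulmx1 mulmxV.
by rewrite fdot_mull mulmxA fdot_form_le_spectral.
Qed.

End Gmres.

(** * One inexact Newton-Kleinman step and perturbation of the Riccati equation *)

Section InexactStep.
Set Implicit Arguments.
Unset Strict Implicit.
Variable R : realType.

(** GMRES is compared with Richardson, whose residual is moved to scaled coordinates, contracted by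
    q^m and moved back. The two changes of coordinates cost |F| and |F^-1|, whence [cond2 F]. *)
Lemma gmres_lyapunov_residual n c (F L M C Z : 'M[R]_n) m : (0 < n)%N ->
  L \in unitmx -> F = L *m L^T -> 0 < c -> dissipative c (invmx L *m M *m L) ->
  gmres_iterate (lyapunov_mx M) (- vec C) m (vec Z) ->
  let S := scaled_lyapunov_mx L M in
  let q := 1 - lambda_min (- (2^-1 *: (S + S^T))) ^+ 2 / lambda_max (S *m S^T) in
  [/\ 0 <= q, q < 1 &
    fdot (C + lyap M Z) (C + lyap M Z) <= cond2 F ^+ 2 * q ^+ m * fdot C C].
Proof.
move=> n0 uL FE c0 dM gm S.
have SE : S = lyapunov_mx (invmx L *m M *m L) by exact: scaled_lyapunov_mxE.
clearbody S.
have N0 : (0 < n * n)%N by rewrite muln_gt0 n0.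
have mu0 : 0 < lambda_min (- (2^-1 *: (S + S^T))).
  (* An eigenvector for the least eigenvalue mu, reshaped into Y, satisfies mu |Y|^2 = - <Y, N^T Y +
     Y N> >= 2 c |Y|^2 with N = L^-1 M L. *)
  have [x x0 Sx] := lambda_min_attained N0 (sym_part_tr S).
  have := fdot_sym_part S x; rewrite Sx fdotZr.
  have [Y xY] := vec_surj x; rewrite xY {3}SE vec_lyapunov !fdot_vec => h.
  have Y0 : 0 < fdot Y Y by rewrite -fdot_vec -xY fdot_gt0.
  rewrite -(pmulr_lgt0 _ Y0) h; have := fdot_sylvester Y dM dM.
  by have := mulr_gt0 c0 Y0; lra.
have [q0 q1 hq] := elman_contraction N0 mu0.
move: q0 q1 hq; set w := (_ / _ in X in _ -> _ -> X -> _); set q := 1 - _ => q0 q1 hq.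
split=> //.
have rE : - vec C - lyapunov_mx M *m vec Z = - vec (C + lyap M Z).
  by rewrite vec_lyapunov vecD opprD.
have := gmres_residual_le w gm; rewrite rE fdotNl fdotNr opprK fdot_vec => h.
apply: (le_trans h); rewrite -vecN richardson_vec fdot_vec.
set W := iter m _ _; rewrite -(congruenceK W uL).
rewrite (le_trans (fdot_congruence_invfactor _ n0 uL FE)) // /W richardson_congruence //.
have -> : cond2 F ^+ 2 * q ^+ m * fdot C C =
    spectral_norm (invmx F) ^+ 2 * (q ^+ m * (spectral_norm F ^+ 2 * fdot C C)).
  by rewrite /cond2; ring.
rewrite ler_wpM2l ?sqr_ge0 // -fdot_vec -richardson_vec -SE.
apply: (le_trans (iter_contraction m q0 hq _)).
rewrite ler_wpM2l ?exprn_ge0 // !fdot_vec.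
by rewrite (le_trans (fdot_congruence_factor _ n0 FE)) // fdotNl fdotNr opprK.
Qed.

(** Taking logarithms, the claim is m ln q <= - 2 ln K, and ln q < 0 reverses the inequality of the
    hypothesis. The side condition excludes q = 0 with m = 0, where [q ^+ m] is 1. *)
Lemma exp_le_of_count (q K : R) m : 0 <= q < 1 -> 0 < K -> (0 < q) || (0 < m)%N ->
  - 2 * ln K / ln q <= m%:R -> q ^+ m * K ^+ 2 <= 1.
Proof.
move=> /andP[q0 q1] K0 qm.
move: qm; have [->|qn0 _] := eqVneq q 0.
  by rewrite ltxx /= => m0 _; rewrite expr0n gtn_eqF // mul0r ler01.
have qp : 0 < q by rewrite lt_def qn0.
have lq : ln q < 0 by rewrite ln_lt0 // qp.
rewrite ler_ndivrMr // => h.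
rewrite -ler_ln ?posrE ?mulr_gt0 ?exprn_gt0 // ln1 lnM ?posrE ?exprn_gt0 // !lnXn //.
rewrite -mulr_natr -[in X in _ + X]mulr_natr; lra.
Qed.

(** Let x be an eigenvector for the least eigenvalue nu of Y. Then <x, [lyap M Y] x> = 2 nu <x, M
    x>, and both forms are negative, which excludes nu < 0. *)
Lemma lyap_neg_psd n c (M Y : 'M[R]_n) : (0 < n)%N -> 0 < c -> dissipative c M -> Y^T = Y ->
  (forall x : 'cV_n, x != 0 -> fdot x (lyap M Y *m x) < 0) -> psd Y.
Proof.
move=> n0 c0 dM symY neg; split=> // y; apply: le_trans (lambda_min_le n0 symY y).
rewrite mulr_ge0 ?fdot_ge0 //.
have [x x0 Yx] := lambda_min_attained n0 symY.
have xYx : fdot x (lyap M Y *m x) = 2 * lambda_min Y * fdot x (M *m x).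
  rewrite /lyap mulmxDl fdotDr -!mulmxA -{2}symY -[fdot x (Y^T *m _)]fdot_mull Yx.
  by rewrite -fdot_mull fdotZr fdotZl (fdotC (M *m x)); ring.
have := neg x x0; have := dM x; have : 0 < fdot x x by rewrite fdot_gt0.
rewrite xYx => xx h1 h2; rewrite leNgt; apply/negP => h3.
have : 0 < lambda_min Y * fdot x (M *m x).
  by rewrite nmulr_rgt0 // (le_lt_trans h1) // mulNr oppr_lt0 mulr_gt0.
lra.
Qed.

Lemma psd_congruence n (L Z : 'M[R]_n) : psd Z -> psd (L^T *m Z *m L).
Proof.
move=> [symZ Z0]; split=> [|x]; first by rewrite !trmx_mul trmxK symZ mulmxA.
by rewrite -!mulmxA -[L in X in fdot _ X]trmxK -fdot_mull trmxK.
Qed.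

Lemma psd_congruence_inv n (L Z : 'M[R]_n) : L \in unitmx -> psd (L^T *m Z *m L) -> psd Z.
Proof.
by move=> uL /(psd_congruence (invmx L)); rewrite congruenceK.
Qed.

(** * Closed loops of positive semidefinite matrices *)

Section ClosedLoop.
Variables (n : nat) (A F L Q : 'M[R]_n) (c : R).
Hypotheses (n0 : (0 < n)%N) (uL : L \in unitmx) (FE : F = L *m L^T).
Hypotheses (c0 : 0 < c) (dB : dissipative c (invmx L *m A *m L)).
Hypothesis pdQ : sym_pos_def Q.

Let symF : F^T = F. Proof. by rewrite FE trmx_mul trmxK. Qed.

(** L^-1 F X L = L^T X L, so only a positive semidefinite form is subtracted, and c does not depend
    on X. *)
Lemma closed_loop_dissipative X : psd X ->
  dissipative c (invmx L *m closed_loop A F X *m L).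
Proof.
move=> pX x; have [_ /(_ x) Y0] := psd_congruence L pX.
have -> : invmx L *m closed_loop A F X *m L = invmx L *m A *m L - L^T *m X *m L.
  by rewrite /closed_loop mulmxBr mulmxBl FE !mulmxA mulVmx // mul1mx.
by rewrite mulmxBl fdotDr fdotNr; have := dB x; lra.
Qed.

Lemma psd_quadratic X : psd X -> psd (X *m F *m X).
Proof.
move=> [symX _]; have -> : X *m F *m X = (L^T *m X)^T *m 1%:M *m (L^T *m X).
  by rewrite trmx_mul symX trmxK FE mulmx1 !mulmxA.
by apply: psd_congruence; split=> [|x]; rewrite ?trmx1 // mul1mx fdot_ge0.
Qed.

(** The count bound makes E = C + [lyap M Z] smaller than [lambda_min Q]; as C - Q is positive
    semidefinite, [lyap M Z] = E - C is negative definite. *)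
Lemma gmres_step_psd X Z m : psd X ->
  gmres_iterate (lyapunov_mx (closed_loop A F X)) (- vec (X *m F *m X + Q)) m (vec Z) ->
  gmres_count_bound A F L Q X <= m%:R -> psd Z.
Proof.
move=> pX gm; rewrite /gmres_count_bound; set M := closed_loop A F X in gm *.
set C := X *m F *m X + Q in gm *.
have dM : dissipative c (invmx L *m M *m L) by exact: closed_loop_dissipative.
have [symXFX XFX0] := psd_quadratic pX.
have symC : C^T = C by rewrite /C linearD /= symXFX (proj1 pdQ).
have symZ := gmres_iterate_sym symC gm.
have := gmres_lyapunov_residual n0 uL FE c0 dM gm.
set S := scaled_lyapunov_mx L M; lazy zeta.
set q := 1 - _; set lQ := lambda_min Q; set E := C + _ => -[q0 q1 hE] hm.
(* For q = 0 the count bound is 0 (ln 0 = 0 and x / 0 = 0) and allows m = 0; then Z = 0. *)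
have [|] := boolP ((0 < q) || (0 < m)%N); last first.
  rewrite negb_or -eqn0Ngt => /andP[_ /eqP m0].
  have -> : Z = 0.
    apply: vec_inj; rewrite vec0; case: gm => -[+ ->] _.
    by rewrite m0 => c'; rewrite big_ord0.
  by split=> [|x]; rewrite ?trmx0 // mul0mx /fdot mulmx0 mxtrace0.
move=> qm.
have lQ0 : 0 < lQ by exact: lambda_min_gt0.
set K := (1 + _) * _ in hm.
have kF0 : 0 <= cond2 F * frobenius_norm C.
  by rewrite !mulr_ge0 ?spectral_norm_ge0 ?frobenius_norm_ge0.
have s0 : 0 < Num.sqrt 2 :> R by rewrite sqrtr_gt0 ltr0n.
have hE' : frobenius_norm E < lQ.
  rewrite -sqr_frobenius_norm -sqr_frobenius_norm mulrAC -exprMn in hE.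
  (* If [cond2 F] |C| = 0, then K = 0 and the logarithmic bound says nothing, but [hE] gives E = 0
     directly. *)
  move: kF0; rewrite le_eqVlt => /predU1P[k0|k0].
    move: hE; rewrite -k0 expr0n mul0r => hE.
    by have := frobenius_norm_ge0 E; nra.
  have K0 : 0 < K by rewrite mulr_gt0 ?addr_gt0 // divr_gt0.
  have := exp_le_of_count (introT andP (conj q0 q1)) K0 qm hm.
  have kE : cond2 F * frobenius_norm C = K * lQ / (1 + Num.sqrt 2).
    by rewrite /K; field; apply/andP; split; rewrite gt_eqF //; lra.
  move: hE; rewrite kE => hE hK.
  (* Dividing by 1 + sqrt 2 > 1 makes the estimate of E strict. *)
  have lt1 : lQ / (1 + Num.sqrt 2) < lQ.
    by rewrite ltr_pdivrMr ?addr_gt0 // ltr_pMr // ltrDl.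
  apply: (le_lt_trans _ lt1).
  rewrite -(@ler_pXn2r _ 2) ?nnegrE ?frobenius_norm_ge0 //; last first.
    by rewrite divr_ge0 ?(ltW lQ0) ?addr_ge0 ?(ltW s0).
  apply: (le_trans hE); rewrite -mulrA exprMn mulrAC -[leRHS]mul1r ler_wpM2r ?sqr_ge0 //.
  by rewrite mulrC.
apply: (psd_congruence_inv uL); apply: (lyap_neg_psd n0 c0 dM).
  by rewrite !trmx_mul trmxK symZ mulmxA.
move=> x x0; rewrite -lyap_congruence // -!mulmxA -fdot_mull.
set y := L *m x; have y0 : y != 0.
  by apply: contraNneq x0 => y0; rewrite -(mulKmx uL x) -/y y0 mulmx0.
have -> : lyap M Z = E - C by rewrite /E addrC addKr.
have yy : 0 < fdot y y by rewrite fdot_gt0.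
have Cy : fdot y (C *m y) = fdot y (X *m F *m X *m y) + fdot y (Q *m y).
  by rewrite -fdotDr -mulmxDl.
rewrite mulmxBl fdotDr fdotNr Cy.
have h1 := fdot_form_le_frobenius E y; have h2 := XFX0 y.
have h3 := lambda_min_le n0 (proj1 pdQ) y; rewrite -/lQ in h3.
have : frobenius_norm E * fdot y y < lQ * fdot y y by rewrite ltr_pM2r.
lra.
Qed.

(** With the closed loop of X1 on the left and that of X2 on the right, the mixed terms X1 F X2
    cancel. *)
Lemma riccati_diff X1 X2 : psd X1 -> psd X2 ->
  (closed_loop A F X1)^T *m (X1 - X2) + (X1 - X2) *m closed_loop A F X2 =
  riccati A F Q X1 - riccati A F Q X2.
Proof.
move=> [s1 _] [s2 _]; rewrite /closed_loop /riccati.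
have -> : (A - F *m X1)^T = A^T - X1 *m F by rewrite linearB /= trmx_mul s1 symF.
rewrite !(mulmxBl, mulmxBr) !mulmxA; apply/matrixP => i j; rewrite !mxE; ring.
Qed.

(** Dissipativity bounds E by G in scaled coordinates; returning from E to X1 - X2 costs |F^-1|, and
    passing from G to D costs |F|. *)
Lemma riccati_lipschitz X1 X2 : psd X1 -> psd X2 ->
  frobenius_norm (X1 - X2) <=
  cond2 F / (2 * c) * frobenius_norm (riccati A F Q X1 - riccati A F Q X2).
Proof.
move=> p1 p2; set E := L^T *m (X1 - X2) *m L; set D := _ - riccati A F Q X2.
set G := L^T *m D *m L.
have EE : fdot E G <= - (2 * c) * fdot E E.
  rewrite /G /D -riccati_diff // sylvester_congruence //.
  exact: fdot_sylvester (closed_loop_dissipative p1) (closed_loop_dissipative p2).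
(* Pairing with -E gives 2 c |E|^2 <= |E| |G|; the case |E| = 0 is treated apart before dividing. *)
have EG : 2 * c * frobenius_norm E <= frobenius_norm G.
  have := fdot_le_frobenius (- E) G; rewrite fdotNl frobenius_normN => h.
  have := frobenius_norm_ge0 E; rewrite le_eqVlt => /predU1P[<-|E0].
    by rewrite mulr0 frobenius_norm_ge0.
  by rewrite -(ler_pM2l E0) (le_trans _ h) // mulrCA -expr2 sqr_frobenius_norm; lra.
have sqr_le a (U V : 'M[R]_n) : 0 <= a -> fdot U U <= a ^+ 2 * fdot V V ->
    frobenius_norm U <= a * frobenius_norm V.
  move=> a0; rewrite -!sqr_frobenius_norm -exprMn ler_pXn2r // nnegrE ?mulr_ge0 //;
  exact: frobenius_norm_ge0.
have hX : frobenius_norm (X1 - X2) <= spectral_norm (invmx F) * frobenius_norm E.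
  apply: sqr_le; first exact: spectral_norm_ge0.
  by rewrite -(congruenceK (X1 - X2) uL) fdot_congruence_invfactor.
have hG : frobenius_norm G <= spectral_norm F * frobenius_norm D.
  by apply: sqr_le; rewrite ?spectral_norm_ge0 // fdot_congruence_factor.
apply: (le_trans hX); rewrite /cond2 [_ * spectral_norm _]mulrC -!mulrA.
rewrite ler_wpM2l ?spectral_norm_ge0 // mulrCA ler_pdivlMl ?mulr_gt0 //.
exact: le_trans EG hG.
Qed.

End ClosedLoop.
End InexactStep.

(** * Stability, entrywise limits and definiteness of solutions *)

Section Convergence.
Set Implicit Arguments.
Unset Strict Implicit.
Variable R : realType.

Lemma stable_similar n (L M : 'M[R]_n) : L \in unitmx ->
  stable (invmx L *m M *m L) -> stable M.
Proof.
move=> uL st z /eigenvalueP [v vM v0]; apply: st; apply/eigenvalueP.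
pose cL := map_mx (real_complex R) L.
have cLV : cL *m map_mx (real_complex R) (invmx L) = 1%:M.
  by rewrite -map_mxM mulmxV // map_mx1.
exists (v *m cL).
  by rewrite !map_mxM !mulmxA -(mulmxA v) cLV mulmx1 vM -scalemxAl.
apply: contraNneq v0 => vL0.
by rewrite -[v]mulmx1 -cLV mulmxA vL0 mul0mx.
Qed.

(** For an eigenvalue a + i b let x and y be the real and imaginary parts of a row eigenvector,
    written as columns. In <x, M^T x> + <y, M^T y> = a (|x|^2 + |y|^2) the terms with b cancel, and
    the left side is at most - c (|x|^2 + |y|^2). *)
Lemma dissipative_stable n c (M : 'M[R]_n) : 0 < c -> dissipative c M -> stable M.
Proof.
move=> c0 dM [a b] /eigenvalueP [v vM v0].
pose x : 'cV[R]_n := \col_j complex.Re (v 0 j).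
pose y : 'cV[R]_n := \col_j complex.Im (v 0 j).
have entry (f : {additive R[i] -> R}) :
    (forall (z : R[i]) (r : R), f (z * r%:C%C) = f z * r) ->
    forall j, f ((v *m map_mx (fun r : R => r%:C%C) M) 0 j) = \sum_k M k j * f (v 0 k).
  move=> fM j; rewrite mxE raddf_sum; apply: eq_bigr => k _.
  by rewrite mxE fM mulrC.
have xM : M^T *m x = a *: x - b *: y.
  apply/colP => j; rewrite !mxE.
  transitivity (complex.Re ((v *m map_mx (fun r : R => r%:C%C) M) 0 j)).
    rewrite (entry (@complex.Re R)) => [|[p q] r /=]; last by rewrite mulr0 subr0.
    by apply: eq_bigr => k _; rewrite !mxE.
  by rewrite vM mxE; case: (v 0 j).
have yM : M^T *m y = b *: x + a *: y.
  apply/colP => j; rewrite !mxE.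
  transitivity (complex.Im ((v *m map_mx (fun r : R => r%:C%C) M) 0 j)).
    rewrite (entry (@complex.Im R)) => [|[p q] r /=]; last by rewrite mulr0 add0r.
    by apply: eq_bigr => k _; rewrite !mxE.
  by rewrite vM mxE; case: (v 0 j) => p q /=; rewrite addrC.
have [xy0|] := boolP (0 < fdot x x + fdot y y); last first.
  rewrite -leNgt => xy0; case/eqP: v0.
  have x0 : fdot x x = 0 by have := fdot_ge0 x; have := fdot_ge0 y; lra.
  have y0 : fdot y y = 0 by have := fdot_ge0 x; have := fdot_ge0 y; lra.
  move/eqP: x0; move/eqP: y0; rewrite !fdot_eq0 => /eqP /colP y0 /eqP /colP x0.
  apply/rowP => j; have := x0 j; have := y0 j; rewrite !mxE.
  by case: (v 0 j) => p q /= -> ->.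
rewrite /= -(pmulr_lle0 _ xy0).
have := dM x; have := dM y; rewrite -!(fdotC (M *m _)) !fdot_mull xM yM.
rewrite !(fdotDr, fdotNr, fdotZr) (fdotC y x) => h1 h2.
have := fdot_ge0 x; have := fdot_ge0 y; nra.
Qed.

(** Working entrywise reduces products to finite sums of scalar limits. *)
Lemma cvg_entries_mulmx m p n (U : nat -> 'M[R]_(m, p)) (V : nat -> 'M[R]_(p, n))
    (U0 : 'M[R]_(m, p)) (V0 : 'M[R]_(p, n)) :
  (forall i j, (fun k => U k i j) @ \oo --> (U0 i j : R)) ->
  (forall i j, (fun k => V k i j) @ \oo --> (V0 i j : R)) ->
  forall i j, (fun k => (U k *m V k) i j) @ \oo --> ((U0 *m V0) i j : R).
Proof.
move=> hU hV i j; rewrite mxE.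
under [X in X @ _]eq_fun do rewrite mxE.
elim: (index_enum 'I_p) => [|l s IH].
  by rewrite big_nil; under [X in X @ _]eq_fun do rewrite big_nil; exact: cvg_cst.
rewrite big_cons; under [X in X @ _]eq_fun do rewrite big_cons.
by apply: cvgD => //; exact: cvgM.
Qed.

Lemma riccati_cvg n (A F Q Xs : 'M[R]_n) (X : nat -> 'M[R]_n) :
  (forall i j, (fun k => X k i j) @ \oo --> (Xs i j : R)) ->
  forall i j, (fun k => riccati A F Q (X k) i j) @ \oo --> (riccati A F Q Xs i j : R).
Proof.
move=> hX i j.
have cst m p (M : 'M[R]_(m, p)) a b : (fun _ : nat => M a b) @ \oo --> (M a b : R).
  exact: cvg_cst.
have RE Y : riccati A F Q Y i j =
    (A^T *m Y) i j + (Y *m A) i j - (Y *m F *m Y) i j + Q i j.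
  by rewrite /riccati !mxE.
rewrite RE; under [X in X @ _]eq_fun do rewrite RE.
apply: cvgD; last exact: cvg_cst.
apply: cvgB; first apply: cvgD.
- exact: cvg_entries_mulmx (cst _ _ A^T) hX i j.
- exact: cvg_entries_mulmx hX (cst _ _ A) i j.
- exact: cvg_entries_mulmx (cvg_entries_mulmx hX (cst _ _ F)) hX i j.
Qed.

Lemma psd_cvg n (Xs : 'M[R]_n) (X : nat -> 'M[R]_n) :
  (forall k, psd (X k)) ->
  (forall i j, (fun k => X k i j) @ \oo --> (Xs i j : R)) -> psd Xs.
Proof.
move=> pX hX; split.
  apply/matrixP => i j; rewrite mxE; apply: (cvg_unique _ (hX j i)) => //.
  rewrite (_ : (fun k => X k j i) = fun k => X k i j); first exact: hX.
  by apply/funext => k; rewrite -[in LHS](proj1 (pX k)) mxE.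
move=> x; rewrite -fdot_cV.
have cst m p (M : 'M[R]_(m, p)) a b : (fun _ : nat => M a b) @ \oo --> (M a b : R).
  exact: cvg_cst.
have h : (fun k => (x^T *m X k *m x) 0 0) @ \oo --> ((x^T *m Xs *m x) 0 0 : R).
  have h1 : forall i j, (fun k => (x^T *m X k) i j) @ \oo --> ((x^T *m Xs) i j : R).
    exact: cvg_entries_mulmx (cst _ _ x^T) hX.
  exact: cvg_entries_mulmx h1 (cst _ _ x) 0 0.
rewrite -(cvg_lim _ h) //; apply: limr_ge; first by apply/cvg_ex; eexists; exact: h.
by apply: nearW => k; rewrite fdot_cV; case: (pX k) => _; apply.
Qed.

Lemma cvg_mx_of_residual n (X : nat -> 'M[R]_n) (K : R) (r : nat -> R) : 0 <= K ->
  (forall k l, frobenius_norm (X k - X l) <= K * (r k + r l)) ->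
  r @ \oo --> (0 : R) -> exists Xs : 'M[R]_n, X @ \oo --> Xs.
Proof.
move=> K0 hX hr; suff : cvg (X @ \oo) by move=> /cvg_ex.
apply: cauchy_cvg; apply: cauchy_exP => e e0.
(* K + 1 in place of K covers K = 0 and gives 2 K d < e. *)
pose d := e / (2 * (K + 1)).
have d0 : 0 < d by rewrite divr_gt0 // mulr_gt0 // ltr_wpDl.
have [N _ hN] : \forall k \near \oo, `|r k| < d by exact: cvgr0_norm_lt.
exists (X N); exists N => // k /= Nk; split=> // i j.
rewrite -ball_normE /ball_ /=.
have := hX N k; have := hN _ Nk; have := hN N (leqnn N).
rewrite !ltr_norml => /andP[_ h1] /andP[_ h2] h3.
have h4 : `|X N i j - X k i j| <= frobenius_norm (X N - X k).
  rewrite -(@ler_pXn2r _ 2) ?nnegrE ?frobenius_norm_ge0 // sqr_frobenius_norm.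
  rewrite real_normK ?num_real //.
  by have := sqr_entry_le_fdot (X N - X k) i j; rewrite !mxE.
have h5 : K * (r N + r k) <= K * (2 * d) by rewrite ler_wpM2l //; lra.
rewrite -ltr_norml (le_lt_trans h4) // (le_lt_trans h3) // (le_lt_trans h5) //.
rewrite /d (_ : K * _ = e * (K / (K + 1))); last by field; rewrite gt_eqF // ltr_wpDl.
by rewrite gtr_pMr // ltr_pdivrMr ?ltr_wpDl // mul1r ltrDl.
Qed.

Lemma cvg0_of_contraction (s : nat -> R) a : 0 < a -> (forall k, 0 <= s k) ->
  (forall k, s k.+1 <= (1 - a) * s k) -> s @ \oo --> (0 : R).
Proof.
(* 1 - a may be negative; the maximum with 0 keeps the geometric ratio in [0, 1). *)
move=> a0 s0 hs; pose rho := Num.max 0 (1 - a).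
have rho0 : 0 <= rho by rewrite le_max lexx.
have rho1 : `|rho| < 1 by rewrite ger0_norm // gt_max ltr01 gtrBl.
have := cvg_geometric (s 0%N) rho1; apply: squeeze_cvgr; last exact: cvg_cst.
apply: nearW => k; rewrite s0 /geometric /=; elim: k => [|k IH].
  by rewrite expr0 mulr1.
rewrite (le_trans (hs k)) // exprS mulrCA.
apply: (@le_trans _ _ (rho * s k)); first by rewrite ler_wpM2r // le_max lexx orbT.
by rewrite ler_wpM2l.
Qed.

(** If <x, X x> = 0 then X x = 0, so every term of <x, R(X) x> containing X vanishes and <x, Q x> =
    0 remains. *)
Lemma riccati_psd_posdef n (A F Q X : 'M[R]_n) : sym_pos_def Q -> psd X ->
  riccati A F Q X = 0 -> sym_pos_def X.
Proof.
move=> [_ Q0] [symX X0] RX; split=> // x x0; rewrite fdot_cV lt_def X0 andbT.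
apply/eqP => xXx.
have Xx : X *m x = 0.
  have := psd_cauchy_schwarz (X *m x) x symX X0; rewrite xXx mulr0 => h.
  by apply/eqP; rewrite -fdot_eq0 -sqrf_eq0 eq_le h sqr_ge0.
have := Q0 x x0; rewrite fdot_cV.
have <- : fdot x (riccati A F Q X *m x) = fdot x (Q *m x); last first.
  by rewrite RX mul0mx /fdot mulmx0 mxtrace0 ltxx.
have xX : fdot x (X *m (A *m x)) = 0.
  by rewrite -symX -fdot_mull Xx /fdot trmx0 mul0mx mxtrace0.
by rewrite /riccati !mulmxDl mulNmx -!mulmxA Xx !mulmx0 oppr0 !addr0 add0r fdotDr xX add0r.
Qed.

End Convergence.

(** * Convergence of the iterates to the stabilizing solution *)

Theorem corollary3p2 (R : realType) (n : nat) (A F L Q : 'M[R]_n)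
    (alpha lam_bar : R) (X Xhat : nat -> 'M[R]_n)
    (it : nat -> nat) (lam : nat -> R) :
  (0 < n)%N ->
  sym_pos_def F -> cholesky_factor F L -> sym_pos_def Q ->
  numerical_range (invmx L *m A *m L) `<=` @open_left_half_plane R ->
  sym_pos_semidef (X 0%N) -> stable (closed_loop A F (X 0%N)) ->
  0 < alpha ->
  inexact_newton_kleinman A F Q alpha X Xhat it lam ->
  (forall k, gmres_count_bound A F L Q (X k) <= (it k)%:R) ->
  0 < lam_bar -> (forall k, lam_bar <= lam k) ->
  (fun k => frobenius_norm (riccati A F Q (X k))) @ \oo --> (0 : R) /\
  exists Xstar : 'M[R]_n,
    [/\ stabilizing_solution A F Q Xstar, sym_pos_def Xstar &
        X @ \oo --> Xstar].
Proof.
move=> n0 _ chol pdQ WB pX0 _ alpha0 NK hit lb0 hlam.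
have uL := cholesky_unit chol; have [_ _ FE] := chol.
have [c c0 dB] := numerical_range_dissipative n0 WB.
(* Since 0 < [lam k] < 1, each new iterate is a convex combination of two positive semidefinite
   matrices. *)
have pX k : psd (X k).
  elim: k => [|k IH]; first exact/sym_pos_semidefE.
  have [gm /andP[l0 l1] -> _] := NK k.
  have [symZ Z0] := gmres_step_psd n0 uL FE c0 dB pdQ IH gm (hit k).
  case: IH => symX X0'; split=> [|x]; first by rewrite linearD !linearZ /= symX symZ.
  rewrite mulmxDl -!scalemxAl fdotDr !fdotZr.
  by rewrite addr_ge0 // mulr_ge0 ?subr_ge0 ?X0' ?Z0 // ltW.
pose s k := spectral_norm (riccati A F Q (X k)).
have s0 k : 0 <= s k by exact: spectral_norm_ge0.
(* The lower bound on the step lengths makes the line search ratio uniform: 1 -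
   [lam_bar * alpha]. *)
have s_cvg : s @ \oo --> (0 : R).
  apply: (@cvg0_of_contraction R s (lam_bar * alpha)) => //; first exact: mulr_gt0.
  move=> k; rewrite /s; have [_ _ XE hS] := NK k; rewrite {1}XE (le_trans hS) //.
  by rewrite ler_wpM2r ?s0 // lerD2l lerN2 ler_wpM2r // ltW.
pose r k := frobenius_norm (riccati A F Q (X k)).
have r_cvg : r @ \oo --> (0 : R).
  pose e : R := frobenius_norm (1%:M : 'M[R]_n).
  have : (fun k => s k * e) @ \oo --> (0 * e : R) by apply: cvgM => //; exact: cvg_cst.
  rewrite mul0r; apply: squeeze_cvgr; last exact: cvg_cst.
  by apply: nearW => k; rewrite frobenius_norm_ge0 frobenius_le_spectral.
split=> //.
have lip := riccati_lipschitz Q n0 uL FE c0 dB.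
have K0 : 0 <= cond2 F / (2 * c).
  by rewrite divr_ge0 ?mulr_ge0 ?spectral_norm_ge0 // ltW.
have [Xs X_cvg] : exists Xs : 'M[R]_n, X @ \oo --> Xs.
  apply: (cvg_mx_of_residual K0 _ r_cvg) => k l.
  rewrite (le_trans (lip _ _ (pX k) (pX l))) // ler_wpM2l //.
  by rewrite (le_trans (frobenius_normD _ _)) // frobenius_normN.
have entry_cvg i j : (fun k => X k i j) @ \oo --> (Xs i j : R).
  apply: (@cvg_comp _ _ _ X (fun M : 'M[R]_n => M i j) _ _ _ X_cvg).
  exact: coord_continuous.
have pXs := psd_cvg pX entry_cvg.
(* The residuals converge entrywise to the residual of [Xs], by continuity, and to 0. *)
have RXs : riccati A F Q Xs = 0.
  apply/matrixP => i j; rewrite [RHS]mxE.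
  have h : (fun k => riccati A F Q (X k) i j) @ \oo --> (riccati A F Q Xs i j : R).
    exact: riccati_cvg.
  apply: (cvg_unique _ h) => //.
  apply: norm_cvg0; move: r_cvg; apply: squeeze_cvgr; last exact: cvg_cst.
  apply: nearW => k; rewrite normr_ge0 /=.
  rewrite -(@ler_pXn2r _ 2) ?nnegrE ?frobenius_norm_ge0 // sqr_frobenius_norm.
  by rewrite real_normK ?num_real // sqr_entry_le_fdot.
exists Xs; split=> //; last exact: riccati_psd_posdef pdQ pXs RXs.
split=> //; first exact/sym_pos_semidefE.
  apply: (stable_similar uL); apply: (dissipative_stable c0).
  exact (closed_loop_dissipative uL FE dB pXs).
(* Two zero residuals in the Lipschitz estimate leave |Y - Xs| <= 0. *)
move=> Y /sym_pos_semidefE pY RY; apply/eqP; rewrite -subr_eq0 -frobenius_norm_eq0.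
rewrite eq_le frobenius_norm_ge0 andbT (le_trans (lip _ _ pY pXs)) //.
by rewrite RY RXs subrr (eqP (_ : frobenius_norm 0 == 0)) ?frobenius_norm_eq0 ?mulr0.
Qed.
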